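(* Let $n$ be a positive integer. For any ordinal space $X$ with $|X|=n+1$ there is an embedding $\Phi\colon X\to\mathbb R^n$ such that $\Phi(X)$ is an independent subset of $\mathbb R^n$ (i.e. the $n+1$ points of $\Phi(X)$ are affinely independent).
   Context: An ordinal space is an ordered triplet $(X,L,\delta)$, also written $(X,\delta)$, where $X$ is a set, $L$ is a linearly ordered set with minimal element $0$, and $\delta\colon X\times X\to L$ is a surjective mapping such that for all $x,y\in X$: (i) $\delta(x,y)=\delta(y,x)$; (ii) $\delta(x,y)=0$ if and only if $x=y$. An embedding of $X$ in $\mathbb R^n$ is a mapping $\Phi\colon X\to\mathbb R^n$ such that for all $x,y,z,w\in X$ the comparison ($<$, $=$ or $>$) of $\delta(x,y)$ with $\delta(z,w)$ is the same as that of the Euclidean distances $d(\Phi(x),\Phi(y))$ and $d(\Phi(z),\Phi(w))$. *)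

(* Defs.v *)
From mathcomp Require Import all_boot all_order all_algebra.
From mathcomp Require Import classical_sets reals.

Set Implicit Arguments.
Unset Strict Implicit.
Unset Printing Implicit Defensive.

Import Order.TTheory GRing.Theory Num.Theory.
Local Open Scope ring_scope.

(* The minimal element 0 of the linearly ordered set L is [\bot]. *)
Record ordinal_space (X : Type) (disp : Order.disp_t) (L : bOrderType disp)
    (delta : X -> X -> L) : Prop := OrdinalSpace {
  ordinal_space_surj : forall l : L, exists x y, delta x y = l;
  ordinal_space_sym : forall x y, delta x y = delta y x;
  ordinal_space_eq0 : forall x y, delta x y = \bot%O <-> x = y
}.

(* The norm that MathComp-Analysis puts on ['rV[R]_n] is the max norm, hence
   an explicit Euclidean distance. *)
Definition euclidean_dist (R : realType) (n : nat) (u v : 'rV[R]_n) : R :=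
  Num.sqrt (\sum_(i < n) (u ord0 i - v ord0 i) ^+ 2).

Definition is_embedding (X : Type) (disp : Order.disp_t) (L : bOrderType disp)
    (delta : X -> X -> L) (R : realType) (n : nat) (Phi : X -> 'rV[R]_n) : Prop :=
  forall x y z w : X,
    let d1 := euclidean_dist (Phi x) (Phi y) in
    let d2 := euclidean_dist (Phi z) (Phi w) in
    [/\ (delta x y < delta z w)%O <-> d1 < d2,
        delta x y = delta z w <-> d1 = d2 &
        (delta x y > delta z w)%O <-> d1 > d2].

(* A is affinely independent: no finite family of distinct points of A has a
   nontrivial vanishing linear combination with coefficients of sum 0. *)
Definition affinely_independent (R : realType) (n : nat)
    (A : set 'rV[R]_n) : Prop :=
  forall (s : seq 'rV[R]_n) (c : 'rV[R]_n -> R),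
    uniq s -> (forall v, v \in s -> A v) ->
    \sum_(v <- s) c v = 0 -> \sum_(v <- s) c v *: v = 0 ->
    forall v, v \in s -> c v = 0.

(* Main.v *)
Require Import Defs.
From mathcomp Require Import all_boot all_order all_algebra.
From mathcomp Require Import classical_sets reals.
From mathcomp Require Import ring lra.

(** Prescribing the squared distances, rather than the points, makes the result
    nearly obvious: any prescription close enough to that of a regular simplex
    is the squared distance matrix of a nondegenerate simplex, and there is
    room near the regular simplex for every ordering of the distances.

    Let [lev l] be the number of pairs whose dissimilarity is below [l], and
    prescribe the squared distance [1 + e * lev (delta x y)] between distinct
    points, for a small [e > 0]. Comparisons of these numbers are those of
    [delta], so any points realizing them give an embedding.

    The criterion for realizability is Schoenberg's: the quadratic form
    [\sum_x \sum_y a x * a y * D x y] is negative at every nonzero [a] whose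
    entries sum to 0. For [D = 1] off the diagonal the form is
    [- \sum_x a x ^+ 2], and a small perturbation cannot change its sign
    ([near_equilateral_negative_type]). The criterion makes the Gram matrix of
    the vectors from one chosen vertex positive definite, so a Cholesky factor
    of it provides the points, in the right dimension ([cholesky],
    [schoenberg]). It also rules out affine dependences, because the form at
    [a] is [-2] times the squared length of [\sum_x a x *: p x]
    ([negative_type_affinely_independent]). *)

Set Implicit Arguments.
Unset Strict Implicit.
Unset Printing Implicit Defensive.

Import Order.TTheory GRing.Theory Num.Theory.
Local Open Scope ring_scope.

(** * Dot products *)

Definition dot (R : pzRingType) (n : nat) (u v : 'rV[R]_n) : R :=
  \sum_(i < n) u ord0 i * v ord0 i.

Lemma dotE (R : pzRingType) n (u v : 'rV[R]_n) : (u *m v^T) 0 0 = dot u v.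
Proof. by rewrite mxE; apply: eq_bigr => i _; rewrite mxE. Qed.

Lemma dot_suml (R : pzRingType) n (T : finType) (a : T -> R)
    (p : T -> 'rV[R]_n) (v : 'rV[R]_n) :
  dot (\sum_x a x *: p x) v = \sum_x a x * dot (p x) v.
Proof.
rewrite -dotE mulmx_suml summxE; apply: eq_bigr => x _.
by rewrite -scalemxAl mxE dotE.
Qed.

Lemma dotC (R : comPzRingType) n (u v : 'rV[R]_n) : dot u v = dot v u.
Proof. by apply: eq_bigr => i _; rewrite mulrC. Qed.

Lemma sqr_dist_dot (R : comPzRingType) n (u v : 'rV[R]_n) :
  \sum_(i < n) (u ord0 i - v ord0 i) ^+ 2 = dot u u + dot v v - 2 * dot u v.
Proof.
by rewrite mulr_sumr -big_split -sumrB; apply: eq_bigr => i _ /=; ring.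
Qed.

(** * Cholesky factorization *)

Lemma quadratic_form_block (R : comPzRingType) m n (t : 'rV[R]_m) (w : 'rV[R]_n)
    (a : 'M_m) (b : 'M_(m, n)) (b' : 'M_(n, m)) (C : 'M_n) :
  row_mx t w *m block_mx a b b' C *m (row_mx t w)^T
  = (t *m a + w *m b') *m t^T + (t *m b + w *m C) *m w^T.
Proof. by rewrite mul_row_block tr_row_mx mul_row_col. Qed.

Lemma mul_lower_block_mx_tr (R : comPzRingType) m n (a : 'M[R]_m)
    (b : 'M_(n, m)) (B : 'M_n) :
  block_mx a 0 b B *m (block_mx a 0 b B)^T
  = block_mx (a *m a^T) (a *m b^T) (b *m a^T) (b *m b^T + B *m B^T).
Proof. by rewrite tr_block_mx mulmx_block !trmx0 !mulmx0 !mul0mx !addr0. Qed.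

(** Completing the square in the first coordinate leaves the Schur complement
    of the top-left entry, which inherits positivity and is factored
    recursively. *)
Lemma cholesky (R : rcfType) n (G : 'M[R]_n) :
  G^T = G -> (forall u : 'rV_n, u != 0 -> 0 < (u *m G *m u^T) 0 0) ->
  exists A : 'M[R]_n, A *m A^T = G.
Proof.
elim: n G => [|n IHn] G symG posG.
  by exists 0; apply/matrixP => -[].
move: (G : 'M_(1 + n)) symG posG => {}G; rewrite -(submxK G).
move: (ulsubmx G) (ursubmx G) (dlsubmx G) (drsubmx G) => a b b' C.
rewrite (tr_block_mx a b b' C) => symG.
have [_ _ <- symC] := @eq_block_mx _ 1 n 1 n _ _ _ _ _ _ _ _ symG.
move=> {b' symG} posG.
have a_gt0 : 0 < a 0 0.
  have := posG (row_mx 1 0 : 'rV_(1 + n)).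
  rewrite (quadratic_form_block 1 0 a b b^T C).
  rewrite !mul1mx !mul0mx !addr0 trmx1 trmx0 mulmx1 mulmx0 addr0; apply.
  apply/negP => /eqP /(congr1 (fun M : 'rV_(1 + n) => M 0 (lshift n 0))).
  by rewrite row_mxEl !mxE => /eqP; rewrite oner_eq0.
have [|w w_neq0|B BBt] := IHn (C - (a 0 0)^-1 *: (b^T *m b)).
- by rewrite linearB linearZ /= trmx_mul trmxK symC.
(* In the next goal, [t] is the first coordinate at which the quadratic form,
   for [w] fixed, is minimal. *)
- pose t := - (a 0 0)^-1 *: (w *m b^T).
  have := posG (row_mx t w : 'rV_(1 + n)).
  have -> : (row_mx t w *m block_mx a b b^T C *m (row_mx t w : 'rV_(1 + n))^T)
      = w *m (C - (a 0 0)^-1 *: (b^T *m b)) *m w^T.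
    rewrite (quadratic_form_block t w a b b^T C).
    have -> : t *m a + w *m b^T = 0.
      rewrite [a]mx11_scalar mul_mx_scalar /t scalerA mulrN divff ?gt_eqF //.
      by rewrite scaleN1r addNr.
    rewrite mul0mx add0r; congr (_ *m _).
    by rewrite mulmxBr addrC /t scaleNr mulNmx -scalemxAl -scalemxAr mulmxA.
  apply; apply: contraNneq w_neq0 => tw0.
  by have /eq_row_mx[_ ->] : row_mx t w = row_mx 0 0 by rewrite tw0 row_mx0.
- pose r := Num.sqrt (a 0 0).
  have rr : r * r = a 0 0 by rewrite -expr2 sqr_sqrtr // ltW.
  have r_neq0 : r != 0 by rewrite gt_eqF // sqrtr_gt0.
  exists (block_mx r%:M 0 (r^-1 *: b^T) B : 'M_(1 + n)).
  rewrite (mul_lower_block_mx_tr r%:M (r^-1 *: b^T) B).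
  rewrite tr_scalar_mx linearZ /= trmxK.
  rewrite !mul_scalar_mx !mul_mx_scalar !scalerA mulfV // !scale1r.
  rewrite -scalemxAl -scalemxAr scalerA -invfM rr BBt addrC subrK.
  by rewrite scale_scalar_mx rr -mx11_scalar.
Qed.

(** * Dissimilarities of strictly negative type *)

(** Schoenberg's condition on a matrix of squared distances; strictness is what
    separates simplices from degenerate configurations. *)
Definition strictly_negative_type (R : numDomainType) (T : finType)
    (D : T -> T -> R) : Prop :=
  forall a : T -> R, \sum_x a x = 0 -> (exists x, a x != 0) ->
    \sum_x \sum_y a x * a y * D x y < 0.

(** With point 0 placed at the origin, the law of cosines dictates the dot
    products [g i j] of the other points. Extending a vector [u] on those
    points to all points by the coordinate that makes its sum vanish turns the
    quadratic form of [g] at [u] into [-1/2] times the form of [D], so the Gram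
    matrix is positive definite and the rows of a Cholesky factor are suitable
    points. *)
Lemma schoenberg (R : rcfType) n (D : 'I_n.+1 -> 'I_n.+1 -> R) :
  (forall i, D i i = 0) -> (forall i j, D i j = D j i) ->
  strictly_negative_type D ->
  exists p : 'I_n.+1 -> 'rV[R]_n,
    forall i j, \sum_(k < n) (p i ord0 k - p j ord0 k) ^+ 2 = D i j.
Proof.
move=> D0 symD negD.
pose g i j := (D i ord0 + D j ord0 - D i j) / 2.
pose G := \matrix_(i < n, j < n) g (lift ord0 i) (lift ord0 j).
have symG : G^T = G.
  by apply/matrixP => i j; rewrite !mxE /g addrC symD addrC (addrC (D _ _)).
have posG (u : 'rV_n) : u != 0 -> 0 < (u *m G *m u^T) 0 0.
  move=> u_neq0.
  pose a i := if unlift ord0 i is Some k then u 0 k else - \sum_k u 0 k.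
  have a0 : a ord0 = - \sum_k u 0 k by rewrite /a unlift_none.
  have aS k : a (lift ord0 k) = u 0 k by rewrite /a liftK.
  have suma : \sum_i a i = 0.
    by rewrite big_ord_recl a0 (eq_bigr _ (fun k _ => aS k)) addNr.
  have /(negD a suma) neg : exists i, a i != 0.
    by have [k uk] := rV0Pn _ u_neq0; exists (lift ord0 k); rewrite aS.
  suff -> : (u *m G *m u^T) 0 0 = - (\sum_i \sum_j a i * a j * D i j) / 2.
    by rewrite divr_gt0 // oppr_gt0.
  have -> : (u *m G *m u^T) 0 0 = \sum_i \sum_j a i * a j * g i j.
    have g0l j : g ord0 j = 0 by rewrite /g D0 add0r symD subrr mul0r.
    have g0r j : g j ord0 = 0 by rewrite /g D0 addr0 subrr mul0r.
    rewrite mxE big_ord_recl [X in _ = X + _]big1 ?add0r; last first.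
      by move=> j _; rewrite g0l mulr0.
    under eq_bigr => j _ do rewrite !mxE mulr_suml.
    rewrite exchange_big; apply: eq_bigr => i _ /=.
    rewrite big_ord_recl g0r mulr0 add0r; apply: eq_bigr => j _.
    by rewrite !mxE !aS mulrAC.
  (* The terms of [g] that depend on [i] alone or on [j] alone contribute
     nothing, as the coordinates of [a] sum to 0. *)
  transitivity (\sum_i a i * D i ord0 / 2 * (\sum_j a j)
      + (\sum_i a i) * (\sum_j a j * D j ord0 / 2)
      - (\sum_i \sum_j a i * a j * D i j) / 2); last first.
    by rewrite suma mul0r -mulr_suml mulr0 !add0r mulNr.
  rewrite !mulr_suml -big_split -sumrB; apply: eq_bigr => i _ /=.
  rewrite !mulr_sumr mulr_suml -big_split -sumrB; apply: eq_bigr => j _ /=.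
  by rewrite /g; field.
have [A AAt] := cholesky symG posG.
pose p i := if unlift ord0 i is Some k then row k A else 0.
have dotp i j : dot (p i) (p j) = g i j.
  rewrite -dotE /p; case: unliftP => [k ->|->]; last first.
    by rewrite mul0mx mxE /g D0 add0r symD subrr mul0r.
  case: unliftP => [l ->|->]; last first.
    by rewrite trmx0 mulmx0 mxE /g D0 addr0 subrr mul0r.
  rewrite tr_row -[LHS](_ : (A *m A^T) k l = _); first by rewrite AAt mxE.
  by rewrite !mxE; apply: eq_bigr => m _; rewrite !mxE.
exists p => i j; rewrite sqr_dist_dot !dotp /g !D0; by field.
Qed.

(** For coefficients [a] of sum 0, expanding the squared distances into dot
    products leaves only the cross terms: the quadratic form at [a] is [-2]
    times the squared length of [\sum_x a x *: p x]. An affine dependence makes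
    this 0, against negativity. *)
Lemma negative_type_affinely_independent (R : realType) n (T : finType)
    (p : T -> 'rV[R]_n) :
  injective p ->
  strictly_negative_type
    (fun x y => \sum_(k < n) (p x ord0 k - p y ord0 k) ^+ 2) ->
  affinely_independent (range p).
Proof.
move=> injp negp s c uniqs sp sumc sumcv.
(* The coefficients of the family [s], carried over to [T] along [p] and
   extended by 0. *)
pose a x := if p x \in s then c (p x) else 0.
have reindexs (V : zmodType) (F : 'rV[R]_n -> V) :
    \sum_(v <- s) F v = \sum_x if p x \in s then F (p x) else 0.
  have perms : perm_eq s [seq p x | x <- enum T & p x \in s].
    apply: uniq_perm => //.
      by rewrite map_inj_uniq // filter_uniq // enum_uniq.
    move=> v; apply/idP/mapP => [vs|[x + ->]]; last first.
      by rewrite mem_filter; case/andP.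
    by have [x _ pxv] := sp v vs; exists x; rewrite // mem_filter mem_enum pxv vs.
  by rewrite (perm_big _ perms) big_map big_filter big_enum_cond big_mkcond.
have suma : \sum_x a x = 0.
  by rewrite -[RHS]sumc reindexs.
have sumap : \sum_x a x *: p x = 0.
  rewrite -[RHS]sumcv reindexs.
  by apply: eq_bigr => x _; rewrite /a; case: ifP; rewrite // scale0r.
move=> v vs; have [x _ pxv] := sp v vs.
have <- : a x = c v by rewrite /a pxv vs.
apply/eqP; apply: contraT => ax_neq0.
have := negp a suma (ex_intro _ x ax_neq0).
suff -> : \sum_y \sum_z a y * a z * (\sum_(k < n) (p y ord0 k - p z ord0 k) ^+ 2)
    = (\sum_y a y * dot (p y) (p y)) * (\sum_z a z)
      + (\sum_y a y) * (\sum_z a z * dot (p z) (p z))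
      - 2 * (\sum_y a y * dot (p y) (\sum_z a z *: p z)).
  rewrite suma sumap mulr0 mul0r add0r big1 ?mulr0 ?subr0 ?ltxx // => y _.
  by rewrite -dotE trmx0 mulmx0 mxE mulr0.
rewrite !mulr_suml mulr_sumr -big_split -sumrB; apply: eq_bigr => y _ /=.
rewrite (dotC _ (\sum_z _)) dot_suml !mulr_sumr -big_split -sumrB.
apply: eq_bigr => z _ /=.
rewrite sqr_dist_dot (dotC (p z) (p y)) -mulr_sumr -!/(dot _ _); ring.
Qed.

(** Subtracting 1 from [D] does not change the form at [a], since the
    coordinates of [a] sum to 0. What remains is [-1] on the diagonal and at
    most [e] in absolute value elsewhere; by
    [`|a x * a y| <= (a x ^+ 2 + a y ^+ 2) / 2] the off-diagonal part is at
    most [e * #|T|] times [\sum_x a x ^+ 2]. *)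
Lemma near_equilateral_negative_type (R : realFieldType) (T : finType)
    (D : T -> T -> R) (e : R) :
  (forall x, D x x = 0) -> (forall x y, x != y -> `|D x y - 1| <= e) ->
  0 <= e -> e * #|T|%:R < 1 -> strictly_negative_type D.
Proof.
move=> D0 De e_ge0 e_lt a suma [x0 ax0].
have -> : \sum_x \sum_y a x * a y * D x y = \sum_x \sum_y a x * a y * (D x y - 1).
  transitivity (\sum_x \sum_y a x * a y * (D x y - 1) + (\sum_x a x) * (\sum_y a y)).
    rewrite mulr_suml -big_split; apply: eq_bigr => x _ /=.
    by rewrite mulr_sumr -big_split; apply: eq_bigr => y _ /=; ring.
  by rewrite suma mul0r addr0.
pose S := \sum_x a x ^+ 2.
have S_gt0 : 0 < S.
  rewrite lt_neqAle sumr_ge0 ?andbT; last by move=> *; exact: sqr_ge0.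
  rewrite eq_sym psumr_neq0; last by move=> *; exact: sqr_ge0.
  by apply/hasP; exists x0; rewrite ?mem_index_enum //= exprn_even_gt0.
apply: (@le_lt_trans _ _ (e * #|T|%:R * S - S)); last first.
  by rewrite subr_lt0 gtr_pMl.
have -> : e * #|T|%:R * S - S
    = \sum_x \sum_y (e * (a x ^+ 2 + a y ^+ 2) / 2 - (x == y)%:R * a x ^+ 2).
  under eq_bigr => x _.
    rewrite sumrB -!mulr_suml -mulr_sumr big_split /= sumr_const -/S.
    rewrite (bigD1 x) //= eqxx big1 ?addr0; last first.
      by move=> y; rewrite eq_sym => /negPf->.
    over.
  rewrite sumrB -!mulr_suml -mulr_sumr big_split /= sumr_const -mulr_sumr mul1r.
  have -> : \sum_x a x ^+ 2 *+ #|T| = S *+ #|T| by rewrite sumrMnl.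
  by rewrite -/S -[S *+ _]mulr_natl; field.
apply: ler_sum => x _; apply: ler_sum => y _.
case: eqVneq => [<-|xy].
  rewrite D0 mulr1n mul1r; have := mulr_ge0 e_ge0 (sqr_ge0 (a x)); lra.
rewrite mul0r subr0; apply: le_trans (ler_norm _) _; rewrite normrM.
apply: le_trans (ler_wpM2l (normr_ge0 _) (De _ _ xy)) _.
rewrite mulrC -mulrA ler_wpM2l // normrM.
rewrite -(real_normK (num_real (a x))) -(real_normK (num_real (a y))).
have := sqr_ge0 (`|a x| - `|a y|); lra.
Qed.

(** * Ordinal spaces *)

Definition level (T : finType) disp (L : porderType disp) (f : T -> L)
    (l : L) : nat :=
  #|[pred y | (f y < l)%O]|.

(** Strictness holds because [l] is itself a value of [f], which is counted at
    [m] and not at [l]. *)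
Lemma level_lt (T : finType) disp (L : porderType disp) (f : T -> L) :
  (forall l, exists x, f x = l) ->
  {homo level f : l m / (l < m)%O >-> (l < m)%N}.
Proof.
move=> fsurj l m lm; apply/proper_card/properP; split.
  by apply/fintype.subsetP => y; rewrite !inE => /lt_trans; apply.
by have [x fx] := fsurj l; exists x; rewrite !inE fx ?ltxx.
Qed.

Theorem proposition8p8 (R : realType) (n : nat) (hn : (0 < n)%N)
    (X : finType) (hX : #|X| = n.+1)
    (disp : Order.disp_t) (L : bOrderType disp) (delta : X -> X -> L)
    (hdelta : ordinal_space delta) :
  exists Phi : X -> 'rV[R]_n,
    is_embedding delta Phi /\ affinely_independent (range Phi).
Proof.
have [surj sym eq0] := hdelta.
pose lev := level (fun xy : X * X => delta xy.1 xy.2).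
have lev_lt : {homo lev : l m / (l < m)%O >-> (l < m)%N}.
  by apply: level_lt => l; have [x [y <-]] := surj l; exists (x, y).
(* Levels are at most [n.+1 ^ 2], the number of pairs, and the perturbation is
   allowed to be anything below [1 / n.+1]. *)
pose e : R := ((n.+1 ^ 3).+1%:R)^-1.
have e_gt0 : 0 < e by rewrite invr_gt0.
pose h (l : L) : R := if l == \bot%O then 0 else 1 + e * (lev l)%:R.
have h_gt0 l : l != \bot%O -> 0 < h l.
  by move=> /negPf lbot; rewrite /h lbot ltr_wpDr // mulr_ge0 // ltW.
have h0 : h \bot%O = 0 by rewrite /h eqxx.
have h_lt : {homo h : l m / (l < m)%O >-> l < m}.
  move=> l m lm.
  have m_neq0 : m != \bot%O.
    by rewrite -lt0x; apply: le_lt_trans lm; exact: le0x.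
  have := h_gt0 m m_neq0; rewrite /h (negPf m_neq0); case: eqP => // _ _.
  by rewrite ltrD2l ltr_pM2l // ltr_nat lev_lt.
pose k l := Num.sqrt (h l).
have k_lt : {homo k : l m / (l < m)%O >-> l < m}.
  move=> l m lm; rewrite /k ltr_sqrt ?h_lt // h_gt0 // -lt0x.
  by apply: le_lt_trans lm; exact: le0x.
have k_mono := le_mono k_lt.
pose g (i : 'I_n.+1) : X := enum_val (cast_ord (esym hX) i).
pose f (x : X) : 'I_n.+1 := cast_ord hX (enum_rank x).
have fK : cancel f g by move=> x; rewrite /g /f cast_ordK enum_rankK.
have gK : cancel g f by move=> i; rewrite /g /f enum_valK cast_ordKV.
pose D i j := h (delta (g i) (g j)).
have D0 i : D i i = 0 by rewrite /D (eq0 _ _).2.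
have symD i j : D i j = D j i by rewrite /D sym.
have negD : strictly_negative_type D.
  apply: (@near_equilateral_negative_type _ _ _ (e * (n.+1 ^ 2)%:R)) => //.
  - move=> i j ij; rewrite /D /h; case: eqP => [/eq0 /(can_inj gK) /eqP|_].
      by rewrite (negPf ij).
    rewrite addrC addKr ger0_norm; last by rewrite mulr_ge0 // ltW.
    rewrite ler_pM2l // ler_nat /lev /level (leq_trans (max_card _)) //.
    by rewrite card_prod hX -mulnn.
  - by rewrite mulr_ge0 // ltW.
  - by rewrite card_ord -mulrA -natrM -expnSr mulrC ltr_pdivrMr // mul1r ltr_nat.
have [p pD] := schoenberg D0 symD negD.
have dist_p i j : euclidean_dist (p i) (p j) = k (delta (g i) (g j)).
  by rewrite /euclidean_dist pD.
have injp : injective p.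
  move=> i j pij; apply/(can_inj gK)/eq0/(inc_inj k_mono).
  by rewrite -dist_p pij dist_p (eq0 _ _).2.
exists (p \o f); split.
  move=> x y z w d1 d2; rewrite /d1 /d2 /= !dist_p !fK !(leW_mono k_mono).
  by split=> //; split=> [->//|/(inc_inj k_mono)].
have -> : range (p \o f) = range p.
  apply/seteqP; split=> [_ [x _ <-]|_ [i _ <-]]; first by exists (f x).
  by exists (g i); rewrite //= gK.
apply: negative_type_affinely_independent => // a suma a_neq0.
under eq_bigr do under eq_bigr do rewrite pD.
exact: negD.
Qed.
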